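(* Let $A$ be a Novikov algebra over $F$ and let $I$ be a maximal right ideal of $A$. If there exist elements $e,f\in A$ such that $a-(a,e,f)\in I$ for every $a\in A$, then the quotient module $A/I$ is an irreducible right Novikov $A$-module.
   Context: $F$ is a field of characteristic different from $2$; all algebras are (not necessarily associative or unital) algebras over $F$. Write $(x,y,z)=(xy)z-x(yz)$. An algebra is a Novikov algebra if it satisfies the identities $(x,y,z)=(y,x,z)$ and $(xy)z=(xz)y$. A maximal right ideal is a proper right ideal (a subspace) maximal among proper right ideals. Right modules. Let $\mathcal N_X$ be the free Novikov algebra over $F$ on countably many generators $X=\{x_1,x_2,\dots\}$. For a vector space $V$ let $T(V)$ be its tensor algebra; a linear map $\varphi:V\to B$ to a unital associative algebra $B$ induces the homomorphism $T(\varphi):T(V)\to B$, $1\mapsto 1$, $v_1\otimes\dots\otimes v_n\mapsto\varphi(v_1)\cdots\varphi(v_n)$. Endomorphisms act on the right: $m(\alpha\beta)=(m\alpha)\beta$. Let $R:\mathcal N_X\to\mathrm{End}(\mathcal N_X)$, $R(f)=R_f$, $gR_f=gf$. Elements of the kernel of $T(R):T(\mathcal N_X)\to\mathrm{End}(\mathcal N_X)$ are called R-identities. For $G(x_1,\dots,x_n)\in T(\mathcal N_X)$ and $a_1,\dots,a_n$ in a Novikov algebra $A$, $G(a_1,\dots,a_n)\in T(A)$ is obtained by substituting $a_i$ for $x_i$. A right (Novikov) representation of $A$ is a linear map $\rho:A\to\mathrm{End}(M)$, $M$ a vector space, such that $T(\rho)(G(a_1,\dots,a_n))=0$ for every R-identity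 $G$ and all $a_i\in A$. The space $M$ with the action $m\cdot a=m\rho(a)$ is then called a right (Novikov) $A$-module. The quotient module $A/I$ by a right ideal $I$ has the action $(x+I)\cdot a=xa+I$. A right $A$-module $M$ is irreducible if it has no nonzero proper submodules and $MA\neq 0$. *)

(* Defs.v *)
(* The classical logic of boolp serves to form quotients by Prop-valued
   relations. *)
From HB Require Import structures.
From mathcomp Require Import all_boot all_algebra.
From mathcomp Require Import boolp.

Set Implicit Arguments.
Unset Strict Implicit.
Unset Printing Implicit Defensive.

Import GRing.Theory.
Local Open Scope ring_scope.
Local Open Scope quotient_scope.

Reserved Notation "x • y" (at level 40, left associativity).

(* Algebras over F, not necessarily associative or unital. *)

HB.mixin Record isNonassocAlgebra (F : fieldType) A of GRing.Lmodule F A := {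
  namul : A -> A -> A;
  namulDl : left_distributive namul +%R;
  namulDr : right_distributive namul +%R;
  namulZl : forall (k : F) (x y : A), namul (k *: x) y = k *: namul x y;
  namulZr : forall (k : F) (x y : A), namul x (k *: y) = k *: namul x y
}.

#[short(type="nonassocAlgType")]
HB.structure Definition NonassocAlgebra (F : fieldType) :=
  {A of GRing.Lmodule F A & isNonassocAlgebra F A}.

Notation "x • y" := (namul x y) : ring_scope.

Definition associator (F : fieldType) (A : nonassocAlgType F) (x y z : A) : A :=
  (x • y) • z - x • (y • z).

HB.mixin Record isNovikov (F : fieldType) A of NonassocAlgebra F A := {
  associatorC12 : forall x y z : A, associator x y z = associator y x z;
  namulAC : forall x y z : A, (x • y) • z = (x • z) • y
}.

#[short(type="novikovAlgType")]
HB.structure Definition NovikovAlgebra (F : fieldType) :=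
  {A of NonassocAlgebra F A & isNovikov F A}.

(* Not MathComp's algType, which requires 1 != 0: this fails for the
   endomorphisms of the zero space. *)
HB.mixin Record isUnitalAssocAlgebra (F : fieldType) B
    of NonassocAlgebra F B := {
  uone : B;
  namulA : forall x y z : B, x • (y • z) = (x • y) • z;
  namul1l : forall x : B, uone • x = x;
  namul1r : forall x : B, x • uone = x
}.

#[short(type="unitalAssocAlgType")]
HB.structure Definition UnitalAssocAlgebra (F : fieldType) :=
  {B of NonassocAlgebra F B & isUnitalAssocAlgebra F B}.

(* The free Novikov algebra on x_0, x_1, ...: formal expressions modulo the
   smallest congruence that contains the axioms of Novikov algebras. *)

Section FreeNovikov.
Variable F : fieldType.

Inductive novterm : Type :=
| NovX of nat
| NovZero
| NovAdd of novterm & novterm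
| NovScale of F & novterm
| NovMul of novterm & novterm.

Local Notation "s +' t" := (NovAdd s t) (at level 50, left associativity).
Local Notation "k *:' t" := (NovScale k t) (at level 40).
Local Notation "s •' t" := (NovMul s t) (at level 40, left associativity).
(* both sides of (s,t,u) = (t,s,u) are written without the formal opposite *)
Local Notation assoc' s t u := ((s •' t) •' u +' (- 1) *:' (s •' (t •' u))).

Inductive noveq : novterm -> novterm -> Prop :=
| noveq_refl t : noveq t t
| noveq_sym s t : noveq s t -> noveq t s
| noveq_trans s t u : noveq s t -> noveq t u -> noveq s u
| noveq_add s s' t t' :
    noveq s s' -> noveq t t' -> noveq (s +' t) (s' +' t')
| noveq_scale k t t' : noveq t t' -> noveq (k *:' t) (k *:' t')
| noveq_mul s s' t t' :
    noveq s s' -> noveq t t' -> noveq (s •' t) (s' •' t')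
| noveq_addA s t u : noveq (s +' (t +' u)) ((s +' t) +' u)
| noveq_addC s t : noveq (s +' t) (t +' s)
| noveq_add0 t : noveq (NovZero +' t) t
| noveq_scaleA a b t : noveq (a *:' (b *:' t)) ((a * b) *:' t)
| noveq_scale0 t : noveq (0 *:' t) NovZero
| noveq_scale1 t : noveq (1 *:' t) t
| noveq_scaleDr k s t : noveq (k *:' (s +' t)) (k *:' s +' k *:' t)
| noveq_scaleDl t a b : noveq ((a + b) *:' t) (a *:' t +' b *:' t)
| noveq_mulDl s t u : noveq ((s +' t) •' u) (s •' u +' t •' u)
| noveq_mulDr s t u : noveq (s •' (t +' u)) (s •' t +' s •' u)
| noveq_mulZl k s t : noveq ((k *:' s) •' t) (k *:' (s •' t))
| noveq_mulZr k s t : noveq (s •' (k *:' t)) (k *:' (s •' t))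
| noveq_assocC12 s t u : noveq (assoc' s t u) (assoc' t s u)
| noveq_mulAC s t u : noveq ((s •' t) •' u) ((s •' u) •' t).

Definition noveqb (s t : {classic novterm}) : bool := `[< noveq s t >].

Lemma noveqb_equiv : equiv_class_of noveqb.
Proof.
split=> [t | s t | t s u].
- by apply/asboolP; exact: noveq_refl.
- by apply/asboolP/asboolP => /noveq_sym.
- by move=> /asboolP st /asboolP tu; apply/asboolP; exact: noveq_trans tu.
Qed.

Canonical noveqb_equiv_rel := EquivRelPack noveqb_equiv.

Definition free_novikov : Type := {eq_quot noveqb}.
HB.instance Definition _ := Choice.on free_novikov.

Definition novclass (t : novterm) : free_novikov :=
  \pi_({eq_quot noveqb}) (t : {classic novterm}).

Definition novrepr (x : free_novikov) : novterm :=
  repr (x : {eq_quot noveqb}).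

Lemma novreprK : cancel novrepr novclass.
Proof. by move=> x; exact: (@reprK _ {eq_quot noveqb}). Qed.

Lemma novclassE s t : novclass s = novclass t <-> noveq s t.
Proof.
split=> [/(@eqmodP _ noveqb_equiv_rel)/asboolP // | st].
by apply/(@eqmodP _ noveqb_equiv_rel)/asboolP.
Qed.

Lemma novreprE t : noveq (novrepr (novclass t)) t.
Proof. by apply/novclassE; rewrite novreprK. Qed.

Definition novadd (x y : free_novikov) := novclass (novrepr x +' novrepr y).
Definition novscale (k : F) (x : free_novikov) := novclass (k *:' novrepr x).
Definition novmul (x y : free_novikov) := novclass (novrepr x •' novrepr y).

Lemma novaddE s t : novadd (novclass s) (novclass t) = novclass (s +' t).
Proof. by apply/novclassE/noveq_add; exact: novreprE. Qed.

Lemma novscaleE k t : novscale k (novclass t) = novclass (k *:' t).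
Proof. by apply/novclassE/noveq_scale; exact: novreprE. Qed.

Lemma novmulE s t : novmul (novclass s) (novclass t) = novclass (s •' t).
Proof. by apply/novclassE/noveq_mul; exact: novreprE. Qed.

Let E := (novaddE, novscaleE, novmulE).

Lemma novaddA : associative novadd.
Proof.
move=> x y z; rewrite -(novreprK x) -(novreprK y) -(novreprK z) !E.
exact/novclassE/noveq_addA.
Qed.

Lemma novaddC : commutative novadd.
Proof.
move=> x y; rewrite -(novreprK x) -(novreprK y) !E.
exact/novclassE/noveq_addC.
Qed.

Lemma novadd0 : left_id (novclass NovZero) novadd.
Proof. by move=> x; rewrite -(novreprK x) !E; exact/novclassE/noveq_add0. Qed.

Lemma novaddN : left_inverse (novclass NovZero) (novscale (- 1)) novadd.
Proof.
move=> x; rewrite -(novreprK x) !E; apply/novclassE.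
set t := novrepr x; apply: noveq_trans (noveq_scale0 t).
rewrite -(addNr (1 : F)).
apply: noveq_trans (noveq_sym (noveq_scaleDl _ _ _)).
by apply: noveq_add; [exact: noveq_refl | exact/noveq_sym/noveq_scale1].
Qed.

HB.instance Definition _ :=
  GRing.isZmodule.Build free_novikov novaddA novaddC novadd0 novaddN.

Lemma novscaleA a b x : novscale a (novscale b x) = novscale (a * b) x.
Proof. by rewrite -(novreprK x) !E; exact/novclassE/noveq_scaleA. Qed.

Lemma novscale1 : left_id 1 novscale.
Proof. by move=> x; rewrite -(novreprK x) !E; exact/novclassE/noveq_scale1. Qed.

Lemma novscaleDr : right_distributive novscale +%R.
Proof.
move=> k x y; rewrite -(novreprK x) -(novreprK y).
by rewrite /GRing.add /= !E; exact/novclassE/noveq_scaleDr.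
Qed.

Lemma novscaleDl x : {morph novscale^~ x : a b / a + b}.
Proof.
move=> a b; rewrite -(novreprK x).
by rewrite [in RHS]/GRing.add /= !E; exact/novclassE/noveq_scaleDl.
Qed.

HB.instance Definition _ := GRing.Zmodule_isLmodule.Build F free_novikov
  novscaleA novscale1 novscaleDr novscaleDl.

Lemma novclassD s t : novclass s + novclass t = novclass (s +' t).
Proof. exact: novaddE. Qed.

Lemma novclassZ k t : k *: novclass t = novclass (k *:' t).
Proof. exact: novscaleE. Qed.

Lemma novmulDl : left_distributive novmul +%R.
Proof.
move=> x y z; rewrite -(novreprK x) -(novreprK y) -(novreprK z).
by rewrite !(novmulE, novclassD); exact/novclassE/noveq_mulDl.
Qed.

Lemma novmulDr : right_distributive novmul +%R.
Proof.
move=> x y z; rewrite -(novreprK x) -(novreprK y) -(novreprK z).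
by rewrite !(novmulE, novclassD); exact/novclassE/noveq_mulDr.
Qed.

Lemma novmulZl (k : F) x y : novmul (k *: x) y = k *: novmul x y.
Proof.
rewrite -(novreprK x) -(novreprK y).
by rewrite novclassZ !novmulE novclassZ; exact/novclassE/noveq_mulZl.
Qed.

Lemma novmulZr (k : F) x y : novmul x (k *: y) = k *: novmul x y.
Proof.
rewrite -(novreprK x) -(novreprK y).
by rewrite novclassZ !novmulE novclassZ; exact/novclassE/noveq_mulZr.
Qed.

HB.instance Definition _ := isNonassocAlgebra.Build F free_novikov
  novmulDl novmulDr novmulZl novmulZr.

Lemma novclassM s t : novclass s • novclass t = novclass (s •' t).
Proof. exact: novmulE. Qed.

Lemma nov_associatorE s t u :
  associator (novclass s) (novclass t) (novclass u) = novclass (assoc' s t u).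
Proof.
rewrite /associator -scaleN1r (novclassM s t) (novclassM t u).
by rewrite (novclassM (s •' t) u) (novclassM s (t •' u)) novclassZ novclassD.
Qed.

Lemma nov_associatorC12 (x y z : free_novikov) :
  associator x y z = associator y x z.
Proof.
rewrite -(novreprK x) -(novreprK y) -(novreprK z) !nov_associatorE.
exact/novclassE/noveq_assocC12.
Qed.

Lemma novclassMM s t u :
  (novclass s • novclass t) • novclass u = novclass ((s •' t) •' u).
Proof. by rewrite (novclassM s t) novclassM. Qed.

Lemma nov_mulAC (x y z : free_novikov) : (x • y) • z = (x • z) • y.
Proof.
rewrite -(novreprK x) -(novreprK y) -(novreprK z) !novclassMM.
exact/novclassE/noveq_mulAC.
Qed.

HB.instance Definition _ :=
  isNovikov.Build F free_novikov nov_associatorC12 nov_mulAC.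

Definition novX (i : nat) : free_novikov := novclass (NovX i).

Section Eval.
Variables (A : novikovAlgType F) (a : nat -> A).

Fixpoint novterm_eval (t : novterm) : A :=
  match t with
  | NovX i => a i
  | NovZero => 0
  | s +' t => novterm_eval s + novterm_eval t
  | k *:' t => k *: novterm_eval t
  | s •' t => novterm_eval s • novterm_eval t
  end.

Lemma novterm_eval_eq s t : noveq s t -> novterm_eval s = novterm_eval t.
Proof.
elim=> {s t} /=; try by move=> *; congruence.
- by move=> *; rewrite addrA.
- by move=> *; rewrite addrC.
- by move=> *; rewrite add0r.
- by move=> *; rewrite scalerA.
- by move=> *; rewrite scale0r.
- by move=> *; rewrite scale1r.
- by move=> *; rewrite scalerDr.
- by move=> *; rewrite scalerDl.
- by move=> *; rewrite namulDl.
- by move=> *; rewrite namulDr.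
- by move=> *; rewrite namulZl.
- by move=> *; rewrite namulZr.
- by move=> s t u; rewrite !scaleN1r; exact: associatorC12.
- by move=> *; rewrite namulAC.
Qed.

(* f(x_0, x_1, ...) |-> f(a_0, a_1, ...) *)
Definition nov_eval (f : free_novikov) : A := novterm_eval (novrepr f).

Lemma nov_evalE t : nov_eval (novclass t) = novterm_eval t.
Proof. by apply: novterm_eval_eq; exact: novreprE. Qed.

Lemma nov_eval_linear : linear nov_eval.
Proof.
move=> k f g; rewrite -(novreprK f) -(novreprK g).
by rewrite novclassZ novclassD !nov_evalE.
Qed.

HB.instance Definition _ :=
  GRing.isLinear.Build F free_novikov A *:%R nov_eval nov_eval_linear.

Lemma nov_evalM f g : nov_eval (f • g) = nov_eval f • nov_eval g.
Proof.
by rewrite -(novreprK f) -(novreprK g) novclassM !nov_evalE.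
Qed.

Lemma nov_evalX i : nov_eval (novX i) = a i.
Proof. by rewrite nov_evalE. Qed.

Lemma nov_eval_unique (h : {linear free_novikov -> A}) :
    (forall f g, h (f • g) = h f • h g) -> (forall i, h (novX i) = a i) ->
  h =1 nov_eval.
Proof.
move=> hM hX f; rewrite -(novreprK f) nov_evalE.
elim: (novrepr f) => {f} /= [||s IHs t IHt|k t IHt|s IHs t IHt].
- exact: hX.
- exact: (linear0 h).
- by rewrite -novclassD linearD IHs IHt.
- by rewrite -novclassZ linearZ IHt.
- by rewrite -novclassM hM IHs IHt.
Qed.

End Eval.
End FreeNovikov.

(* The tensor algebra T(V): formal expressions in the elements of V modulo the
   smallest congruence that contains the axioms of unital associative algebras
   and the linearity of the inclusion of V. *)

Section TensorAlgebra.
Variables (F : fieldType) (V : lmodType F).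

Inductive tensterm : Type :=
| TensV of V
| TensZero
| TensOne
| TensAdd of tensterm & tensterm
| TensScale of F & tensterm
| TensMul of tensterm & tensterm.

Local Notation "s +' t" := (TensAdd s t) (at level 50, left associativity).
Local Notation "k *:' t" := (TensScale k t) (at level 40).
Local Notation "s •' t" := (TensMul s t) (at level 40, left associativity).

Inductive tenseq : tensterm -> tensterm -> Prop :=
| tenseq_refl t : tenseq t t
| tenseq_sym s t : tenseq s t -> tenseq t s
| tenseq_trans s t u : tenseq s t -> tenseq t u -> tenseq s u
| tenseq_add s s' t t' :
    tenseq s s' -> tenseq t t' -> tenseq (s +' t) (s' +' t')
| tenseq_scale k t t' : tenseq t t' -> tenseq (k *:' t) (k *:' t')
| tenseq_mul s s' t t' :
    tenseq s s' -> tenseq t t' -> tenseq (s •' t) (s' •' t')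
| tenseq_addA s t u : tenseq (s +' (t +' u)) ((s +' t) +' u)
| tenseq_addC s t : tenseq (s +' t) (t +' s)
| tenseq_add0 t : tenseq (TensZero +' t) t
| tenseq_scaleA a b t : tenseq (a *:' (b *:' t)) ((a * b) *:' t)
| tenseq_scale0 t : tenseq (0 *:' t) TensZero
| tenseq_scale1 t : tenseq (1 *:' t) t
| tenseq_scaleDr k s t : tenseq (k *:' (s +' t)) (k *:' s +' k *:' t)
| tenseq_scaleDl t a b : tenseq ((a + b) *:' t) (a *:' t +' b *:' t)
| tenseq_mulA s t u : tenseq (s •' (t •' u)) ((s •' t) •' u)
| tenseq_mul1l t : tenseq (TensOne •' t) t
| tenseq_mul1r t : tenseq (t •' TensOne) t
| tenseq_mulDl s t u : tenseq ((s +' t) •' u) (s •' u +' t •' u)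
| tenseq_mulDr s t u : tenseq (s •' (t +' u)) (s •' t +' s •' u)
| tenseq_mulZl k s t : tenseq ((k *:' s) •' t) (k *:' (s •' t))
| tenseq_mulZr k s t : tenseq (s •' (k *:' t)) (k *:' (s •' t))
| tenseq_VD u v : tenseq (TensV (u + v)) (TensV u +' TensV v)
| tenseq_VZ k v : tenseq (TensV (k *: v)) (k *:' TensV v).

Definition tenseqb (s t : {classic tensterm}) : bool := `[< tenseq s t >].

Lemma tenseqb_equiv : equiv_class_of tenseqb.
Proof.
split=> [t | s t | t s u].
- by apply/asboolP; exact: tenseq_refl.
- by apply/asboolP/asboolP => /tenseq_sym.
- by move=> /asboolP st /asboolP tu; apply/asboolP; exact: tenseq_trans tu.
Qed.

Canonical tenseqb_equiv_rel := EquivRelPack tenseqb_equiv.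

Definition tensor_algebra : Type := {eq_quot tenseqb}.
HB.instance Definition _ := Choice.on tensor_algebra.

Definition tensclass (t : tensterm) : tensor_algebra :=
  \pi_({eq_quot tenseqb}) (t : {classic tensterm}).

Definition tensrepr (x : tensor_algebra) : tensterm :=
  repr (x : {eq_quot tenseqb}).

Lemma tensreprK : cancel tensrepr tensclass.
Proof. by move=> x; exact: (@reprK _ {eq_quot tenseqb}). Qed.

Lemma tensclassE s t : tensclass s = tensclass t <-> tenseq s t.
Proof.
split=> [/(@eqmodP _ tenseqb_equiv_rel)/asboolP // | st].
by apply/(@eqmodP _ tenseqb_equiv_rel)/asboolP.
Qed.

Lemma tensreprE t : tenseq (tensrepr (tensclass t)) t.
Proof. by apply/tensclassE; rewrite tensreprK. Qed.

Definition tensadd (x y : tensor_algebra) :=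
  tensclass (tensrepr x +' tensrepr y).
Definition tensscale (k : F) (x : tensor_algebra) :=
  tensclass (k *:' tensrepr x).
Definition tensmul (x y : tensor_algebra) :=
  tensclass (tensrepr x •' tensrepr y).

Lemma tensaddE s t : tensadd (tensclass s) (tensclass t) = tensclass (s +' t).
Proof. by apply/tensclassE/tenseq_add; exact: tensreprE. Qed.

Lemma tensscaleE k t : tensscale k (tensclass t) = tensclass (k *:' t).
Proof. by apply/tensclassE/tenseq_scale; exact: tensreprE. Qed.

Lemma tensmulE s t : tensmul (tensclass s) (tensclass t) = tensclass (s •' t).
Proof. by apply/tensclassE/tenseq_mul; exact: tensreprE. Qed.

Let E := (tensaddE, tensscaleE, tensmulE).

Lemma tensaddA : associative tensadd.
Proof.
move=> x y z; rewrite -(tensreprK x) -(tensreprK y) -(tensreprK z) !E.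
exact/tensclassE/tenseq_addA.
Qed.

Lemma tensaddC : commutative tensadd.
Proof.
move=> x y; rewrite -(tensreprK x) -(tensreprK y) !E.
exact/tensclassE/tenseq_addC.
Qed.

Lemma tensadd0 : left_id (tensclass TensZero) tensadd.
Proof. by move=> x; rewrite -(tensreprK x) !E; exact/tensclassE/tenseq_add0. Qed.

Lemma tensaddN : left_inverse (tensclass TensZero) (tensscale (- 1)) tensadd.
Proof.
move=> x; rewrite -(tensreprK x) !E; apply/tensclassE.
set t := tensrepr x; apply: tenseq_trans (tenseq_scale0 t).
rewrite -(addNr (1 : F)).
apply: tenseq_trans (tenseq_sym (tenseq_scaleDl _ _ _)).
by apply: tenseq_add; [exact: tenseq_refl | exact/tenseq_sym/tenseq_scale1].
Qed.

HB.instance Definition _ :=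
  GRing.isZmodule.Build tensor_algebra tensaddA tensaddC tensadd0 tensaddN.

Lemma tensscaleA a b x : tensscale a (tensscale b x) = tensscale (a * b) x.
Proof. by rewrite -(tensreprK x) !E; exact/tensclassE/tenseq_scaleA. Qed.

Lemma tensscale1 : left_id 1 tensscale.
Proof.
by move=> x; rewrite -(tensreprK x) !E; exact/tensclassE/tenseq_scale1.
Qed.

Lemma tensscaleDr : right_distributive tensscale +%R.
Proof.
move=> k x y; rewrite -(tensreprK x) -(tensreprK y).
by rewrite /GRing.add /= !E; exact/tensclassE/tenseq_scaleDr.
Qed.

Lemma tensscaleDl x : {morph tensscale^~ x : a b / a + b}.
Proof.
move=> a b; rewrite -(tensreprK x).
by rewrite [in RHS]/GRing.add /= !E; exact/tensclassE/tenseq_scaleDl.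
Qed.

HB.instance Definition _ := GRing.Zmodule_isLmodule.Build F tensor_algebra
  tensscaleA tensscale1 tensscaleDr tensscaleDl.

Lemma tensclassD s t : tensclass s + tensclass t = tensclass (s +' t).
Proof. exact: tensaddE. Qed.

Lemma tensclassZ k t : k *: tensclass t = tensclass (k *:' t).
Proof. exact: tensscaleE. Qed.

Lemma tensmulDl : left_distributive tensmul +%R.
Proof.
move=> x y z; rewrite -(tensreprK x) -(tensreprK y) -(tensreprK z).
by rewrite !(tensmulE, tensclassD); exact/tensclassE/tenseq_mulDl.
Qed.

Lemma tensmulDr : right_distributive tensmul +%R.
Proof.
move=> x y z; rewrite -(tensreprK x) -(tensreprK y) -(tensreprK z).
by rewrite !(tensmulE, tensclassD); exact/tensclassE/tenseq_mulDr.
Qed.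

Lemma tensmulZl (k : F) x y : tensmul (k *: x) y = k *: tensmul x y.
Proof.
rewrite -(tensreprK x) -(tensreprK y).
by rewrite tensclassZ !tensmulE tensclassZ; exact/tensclassE/tenseq_mulZl.
Qed.

Lemma tensmulZr (k : F) x y : tensmul x (k *: y) = k *: tensmul x y.
Proof.
rewrite -(tensreprK x) -(tensreprK y).
by rewrite tensclassZ !tensmulE tensclassZ; exact/tensclassE/tenseq_mulZr.
Qed.

HB.instance Definition _ := isNonassocAlgebra.Build F tensor_algebra
  tensmulDl tensmulDr tensmulZl tensmulZr.

Lemma tensclassM s t : tensclass s • tensclass t = tensclass (s •' t).
Proof. exact: tensmulE. Qed.

Lemma tensmulA (x y z : tensor_algebra) : x • (y • z) = (x • y) • z.
Proof.
rewrite -(tensreprK x) -(tensreprK y) -(tensreprK z).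
rewrite (tensclassM (tensrepr y)) (tensclassM (tensrepr x)) !tensclassM.
exact/tensclassE/tenseq_mulA.
Qed.

Lemma tensmul1l (x : tensor_algebra) : tensclass TensOne • x = x.
Proof.
by rewrite -(tensreprK x) tensclassM; exact/tensclassE/tenseq_mul1l.
Qed.

Lemma tensmul1r (x : tensor_algebra) : x • tensclass TensOne = x.
Proof.
by rewrite -(tensreprK x) tensclassM; exact/tensclassE/tenseq_mul1r.
Qed.

HB.instance Definition _ := isUnitalAssocAlgebra.Build F tensor_algebra
  tensmulA tensmul1l tensmul1r.

Definition tens_in (v : V) : tensor_algebra := tensclass (TensV v).

Lemma tens_in_linear : linear tens_in.
Proof.
move=> k u v; rewrite tensclassZ tensclassD; apply/tensclassE.
apply: tenseq_trans (tenseq_VD _ _) _.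
by apply: tenseq_add (tenseq_refl _); exact: tenseq_VZ.
Qed.

HB.instance Definition _ :=
  GRing.isLinear.Build F V tensor_algebra *:%R tens_in tens_in_linear.

Section Lift.
Variables (B : unitalAssocAlgType F) (phi : {linear V -> B}).

Fixpoint tensterm_eval (t : tensterm) : B :=
  match t with
  | TensV v => phi v
  | TensZero => 0
  | TensOne => uone
  | s +' t => tensterm_eval s + tensterm_eval t
  | k *:' t => k *: tensterm_eval t
  | s •' t => tensterm_eval s • tensterm_eval t
  end.

Lemma tensterm_eval_eq s t : tenseq s t -> tensterm_eval s = tensterm_eval t.
Proof.
elim=> {s t} /=; try by move=> *; congruence.
- by move=> *; rewrite addrA.
- by move=> *; rewrite addrC.
- by move=> *; rewrite add0r.
- by move=> *; rewrite scalerA.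
- by move=> *; rewrite scale0r.
- by move=> *; rewrite scale1r.
- by move=> *; rewrite scalerDr.
- by move=> *; rewrite scalerDl.
- by move=> *; rewrite namulA.
- by move=> *; rewrite namul1l.
- by move=> *; rewrite namul1r.
- by move=> *; rewrite namulDl.
- by move=> *; rewrite namulDr.
- by move=> *; rewrite namulZl.
- by move=> *; rewrite namulZr.
- by move=> *; rewrite linearD.
- by move=> *; rewrite linearZ.
Qed.

(* T(phi) : T(V) -> B *)
Definition tens_lift (G : tensor_algebra) : B := tensterm_eval (tensrepr G).

Lemma tens_liftE t : tens_lift (tensclass t) = tensterm_eval t.
Proof. by apply: tensterm_eval_eq; exact: tensreprE. Qed.

Lemma tens_lift_linear : linear tens_lift.
Proof.
move=> k f g; rewrite -(tensreprK f) -(tensreprK g).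
by rewrite tensclassZ tensclassD !tens_liftE.
Qed.

HB.instance Definition _ :=
  GRing.isLinear.Build F tensor_algebra B *:%R tens_lift tens_lift_linear.

Lemma tens_lift1 : tens_lift uone = uone.
Proof. exact: tens_liftE. Qed.

Lemma tens_liftM f g : tens_lift (f • g) = tens_lift f • tens_lift g.
Proof. by rewrite -(tensreprK f) -(tensreprK g) tensclassM !tens_liftE. Qed.

Lemma tens_lift_in v : tens_lift (tens_in v) = phi v.
Proof. by rewrite tens_liftE. Qed.

Lemma tens_lift_unique (h : {linear tensor_algebra -> B}) :
    h uone = uone -> (forall f g, h (f • g) = h f • h g) ->
    (forall v, h (tens_in v) = phi v) ->
  h =1 tens_lift.
Proof.
move=> h1 hM hV f; rewrite -(tensreprK f) tens_liftE.
elim: (tensrepr f) => {f} /= [||| s IHs t IHt | k t IHt | s IHs t IHt].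
- exact: hV.
- exact: (linear0 h).
- exact: h1.
- by rewrite -tensclassD linearD IHs IHt.
- by rewrite -tensclassZ linearZ IHt.
- by rewrite -tensclassM hM IHs IHt.
Qed.

End Lift.
End TensorAlgebra.

(* End(M) with endomorphisms acting on the right: m (alpha beta) =
   (m alpha) beta, so that alpha • beta applies alpha first. *)

Section RightEndomorphisms.
Variables (F : fieldType) (M : lmodType F).

Record rEnd : Type := REnd { rEnd_fun :> M -> M; _ : linear rEnd_fun }.

Lemma rEnd_linear (f : rEnd) : linear f. Proof. by case: f. Qed.

HB.instance Definition _ (f : rEnd) :=
  GRing.isLinear.Build F M M *:%R (rEnd_fun f) (rEnd_linear f).

Lemma rEndP (f g : rEnd) : f =1 g -> f = g.
Proof.
case: f g => [f fL] [g gL] /= /funext fg.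
by case: g / fg gL => gL; congr REnd; exact: Prop_irrelevance.
Qed.

HB.instance Definition _ := gen_eqMixin rEnd.
HB.instance Definition _ := gen_choiceMixin rEnd.

Fact rEnd0_linear : linear (fun _ : M => 0 : M).
Proof. by move=> k x y; rewrite scaler0 addr0. Qed.
Fact rEndN_linear (f : rEnd) : linear (fun m => - f m).
Proof. by move=> k x y; rewrite linearP opprD scalerN. Qed.
Fact rEndD_linear (f g : rEnd) : linear (fun m => f m + g m).
Proof. by move=> k x y; rewrite !linearP scalerDr addrACA. Qed.
Fact rEndZ_linear (c : F) (f : rEnd) : linear (fun m => c *: f m).
Proof. by move=> k x y; rewrite linearP scalerDr !scalerA mulrC. Qed.
Fact rEnd1_linear : linear (fun m : M => m).
Proof. by []. Qed.
Fact rEndM_linear (f g : rEnd) : linear (fun m => g (f m)).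
Proof. by move=> k x y; rewrite !linearP. Qed.

Definition rEnd0 := REnd rEnd0_linear.
Definition rEndN f := REnd (rEndN_linear f).
Definition rEndD f g := REnd (rEndD_linear f g).
Definition rEndZ c f := REnd (rEndZ_linear c f).
Definition rEnd1 := REnd rEnd1_linear.
Definition rEndM f g := REnd (rEndM_linear f g).

Fact rEndDA : associative rEndD.
Proof. by move=> f g h; apply: rEndP => m /=; rewrite addrA. Qed.
Fact rEndDC : commutative rEndD.
Proof. by move=> f g; apply: rEndP => m /=; rewrite addrC. Qed.
Fact rEnd0D : left_id rEnd0 rEndD.
Proof. by move=> f; apply: rEndP => m /=; rewrite add0r. Qed.
Fact rEndND : left_inverse rEnd0 rEndN rEndD.
Proof. by move=> f; apply: rEndP => m /=; rewrite addNr. Qed.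

HB.instance Definition _ :=
  GRing.isZmodule.Build rEnd rEndDA rEndDC rEnd0D rEndND.

Fact rEndZA a b f : rEndZ a (rEndZ b f) = rEndZ (a * b) f.
Proof. by apply: rEndP => m /=; rewrite scalerA. Qed.
Fact rEnd1Z : left_id 1 rEndZ.
Proof. by move=> f; apply: rEndP => m /=; rewrite scale1r. Qed.
Fact rEndZDr : right_distributive rEndZ +%R.
Proof. by move=> k f g; apply: rEndP => m /=; rewrite scalerDr. Qed.
Fact rEndZDl f : {morph rEndZ^~ f : a b / a + b}.
Proof. by move=> a b; apply: rEndP => m /=; rewrite scalerDl. Qed.

HB.instance Definition _ :=
  GRing.Zmodule_isLmodule.Build F rEnd rEndZA rEnd1Z rEndZDr rEndZDl.

Fact rEndMDl : left_distributive rEndM +%R.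
Proof. by move=> f g h; apply: rEndP => m /=; rewrite linearD. Qed.
Fact rEndMDr : right_distributive rEndM +%R.
Proof. by move=> f g h; exact: rEndP. Qed.
Fact rEndMZl (k : F) (f g : rEnd) : rEndM (k *: f) g = k *: rEndM f g.
Proof. by apply: rEndP => m /=; rewrite linearZ. Qed.
Fact rEndMZr (k : F) (f g : rEnd) : rEndM f (k *: g) = k *: rEndM f g.
Proof. exact: rEndP. Qed.

HB.instance Definition _ :=
  isNonassocAlgebra.Build F rEnd rEndMDl rEndMDr rEndMZl rEndMZr.

Fact rEndMA (f g h : rEnd) : f • (g • h) = (f • g) • h.
Proof. exact: rEndP. Qed.
Fact rEnd1M (f : rEnd) : rEnd1 • f = f.
Proof. exact: rEndP. Qed.
Fact rEndM1 (f : rEnd) : f • rEnd1 = f.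
Proof. exact: rEndP. Qed.

HB.instance Definition _ :=
  isUnitalAssocAlgebra.Build F rEnd rEndMA rEnd1M rEndM1.

Lemma rEndM_act (f g : rEnd) m : (f • g) m = g (f m).
Proof. by []. Qed.

End RightEndomorphisms.

(* R : A -> End(A), g R_f = g f *)

Section RightMultiplication.
Variables (F : fieldType) (A : nonassocAlgType F).

Fact rmul_act_linear (f : A) : linear (fun g : A => g • f).
Proof. by move=> k x y; rewrite namulDl namulZl. Qed.

Definition rmul (f : A) : rEnd A := REnd (rmul_act_linear f).

Fact rmul_linear : linear rmul.
Proof. by move=> k x y; apply: rEndP => m /=; rewrite namulDr namulZr. Qed.

HB.instance Definition _ :=
  GRing.isLinear.Build F A (rEnd A) *:%R rmul rmul_linear.

End RightMultiplication.

Definition R_identity (F : fieldType)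
    (G : tensor_algebra (free_novikov F)) : Prop :=
  tens_lift (@rmul F (free_novikov F)) G = 0.

(* G(a_0, a_1, ...) in T(A): the substitution x_i |-> a_i. Only finitely many
   generators occur in G, so that a total assignment a is no restriction. *)
Definition tens_subst (F : fieldType) (A : novikovAlgType F) (a : nat -> A)
    (G : tensor_algebra (free_novikov F)) : tensor_algebra A :=
  tens_lift (@tens_in F A \o nov_eval a) G.

Definition right_representation (F : fieldType) (A : novikovAlgType F)
    (M : lmodType F) (rho : {linear A -> rEnd M}) : Prop :=
  forall G : tensor_algebra (free_novikov F), R_identity G ->
  forall a : nat -> A, tens_lift rho (tens_subst a G) = 0.

Structure rightModule (F : fieldType) (A : novikovAlgType F) := RightModule {
  rm_space : lmodType F;
  rm_rho : {linear A -> rEnd rm_space};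
  _ : right_representation rm_rho
}.

(* m · a *)
Definition rm_act (F : fieldType) (A : novikovAlgType F) (M : rightModule A)
    (m : rm_space M) (a : A) : rm_space M := rm_rho M a m.

Definition submodule (F : fieldType) (A : novikovAlgType F)
    (M : rightModule A) (W : submodClosed (rm_space M)) : Prop :=
  forall m a, m \in W -> rm_act m a \in W.

(* The last conjunct is MA <> 0. *)
Definition irreducible_rightModule (F : fieldType) (A : novikovAlgType F)
    (M : rightModule A) : Prop :=
  (forall W : submodClosed (rm_space M), submodule W ->
     (forall m, m \in W -> m = 0) \/ (forall m, m \in W)) /\
  (exists m a, @rm_act F A M m a <> 0).

HB.mixin Record isRightMulClosed (F : fieldType) (A : nonassocAlgType F)
    (I : {pred A}) := {
  rightMulClosedP : forall x a : A, x \in I -> x • a \in I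
}.

#[short(type="rightIdeal")]
HB.structure Definition RightIdeal (F : fieldType) (A : nonassocAlgType F) :=
  {I of @GRing.SubmodClosed F A I & @isRightMulClosed F A I}.

Definition proper_rightIdeal (F : fieldType) (A : nonassocAlgType F)
    (I : rightIdeal A) : Prop := exists x : A, x \notin I.

Definition maximal_rightIdeal (F : fieldType) (A : nonassocAlgType F)
    (I : rightIdeal A) : Prop :=
  proper_rightIdeal I /\
  forall J : rightIdeal A, proper_rightIdeal J ->
    {subset I <= J} -> {subset J <= I}.

Section QuotientSpace.
Variables (F : fieldType) (V : lmodType F) (W : submodClosed V).

Fact subspace_zmod_closed : zmod_closed W.
Proof.
by split=> [|x y xW yW]; rewrite ?rpred0 // rpredD // -scaleN1r rpredZ.
Qed.

Definition subspace_pred : {pred V} := W.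
HB.instance Definition _ :=
  GRing.isZmodClosed.Build V subspace_pred subspace_zmod_closed.
Definition subspace_zmod : zmodClosed V := subspace_pred.

Definition quot_space : Type := Quotient.quot subspace_zmod.
HB.instance Definition _ := GRing.Zmodule.on quot_space.

(* x |-> x + W *)
Definition vcoset (x : V) : quot_space := \pi_(Quotient.quot subspace_zmod) x.

Lemma vcosetP x y : vcoset x = vcoset y <-> x - y \in W.
Proof.
change (vcoset x = vcoset y <-> Quotient.equiv subspace_zmod x y).
split=> [/(@eqmodP _ (Quotient.equiv_equiv subspace_zmod)) // | xy].
exact/(@eqmodP _ (Quotient.equiv_equiv subspace_zmod)).
Qed.

Definition vcoset_repr (q : quot_space) : V := repr (q : Quotient.quot subspace_zmod).

Lemma vcoset_reprK : cancel vcoset_repr vcoset.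
Proof. by move=> q; exact: (@reprK _ (Quotient.quot subspace_zmod)). Qed.

Lemma vcoset_reprB x : vcoset_repr (vcoset x) - x \in W.
Proof. by apply/vcosetP; rewrite vcoset_reprK. Qed.

Lemma vcosetD x y : vcoset (x + y) = vcoset x + vcoset y.
Proof. exact: (Quotient.pi_add subspace_zmod). Qed.

Definition quot_scale (k : F) (q : quot_space) : quot_space :=
  vcoset (k *: vcoset_repr q).

Lemma quot_scaleE k x : quot_scale k (vcoset x) = vcoset (k *: x).
Proof. by apply/vcosetP; rewrite -scalerBr rpredZ // vcoset_reprB. Qed.

Fact quot_scaleA a b q : quot_scale a (quot_scale b q) = quot_scale (a * b) q.
Proof. by rewrite -(vcoset_reprK q) !quot_scaleE scalerA. Qed.
Fact quot_scale1 : left_id 1 quot_scale.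
Proof. by move=> q; rewrite -(vcoset_reprK q) !quot_scaleE scale1r. Qed.
Fact quot_scaleDr : right_distributive quot_scale +%R.
Proof.
move=> k p q; rewrite -(vcoset_reprK p) -(vcoset_reprK q).
by rewrite -vcosetD !quot_scaleE scalerDr vcosetD.
Qed.
Fact quot_scaleDl q : {morph quot_scale^~ q : a b / a + b}.
Proof.
by move=> a b; rewrite -(vcoset_reprK q) !quot_scaleE scalerDl vcosetD.
Qed.

HB.instance Definition _ := GRing.Zmodule_isLmodule.Build F quot_space
  quot_scaleA quot_scale1 quot_scaleDr quot_scaleDl.

Fact vcoset_linear : linear vcoset.
Proof. by move=> k x y; rewrite vcosetD -quot_scaleE. Qed.

HB.instance Definition _ :=
  GRing.isLinear.Build F V quot_space *:%R vcoset vcoset_linear.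

End QuotientSpace.

(* The action (x + I) · a = x a + I on A / I. *)

Section QuotientAction.
Variables (F : fieldType) (A : nonassocAlgType F) (I : rightIdeal A).

Definition quot_act_fun (a : A) (q : quot_space I) : quot_space I :=
  vcoset I (vcoset_repr q • a).

Lemma quot_act_funE a x : quot_act_fun a (vcoset I x) = vcoset I (x • a).
Proof.
apply/vcosetP; rewrite -scaleN1r -namulZl -namulDl scaleN1r.
by apply: rightMulClosedP; exact: vcoset_reprB.
Qed.

Fact quot_act_fun_linear a : linear (quot_act_fun a).
Proof.
move=> k p q; rewrite -(vcoset_reprK p) -(vcoset_reprK q) -linearP.
by rewrite !quot_act_funE namulDl namulZl linearP.
Qed.

Definition quot_act (a : A) : rEnd (quot_space I) :=
  REnd (quot_act_fun_linear a).

Fact quot_act_linear : linear quot_act.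
Proof.
move=> k a b; apply: rEndP => q /=; rewrite -(vcoset_reprK q).
by rewrite !quot_act_funE namulDr namulZr linearP.
Qed.

HB.instance Definition _ :=
  GRing.isLinear.Build F A (rEnd (quot_space I)) *:%R quot_act quot_act_linear.

End QuotientAction.

(* Main.v *)
(* Every R-identity acts as zero on A/I: given a coset x + I and an assignment
   a, evaluate a generator not occurring in the identity at x and the other
   generators along a; the induced map of the free algebra to A/I intertwines
   the two actions. Submodules of A/I correspond to right ideals containing I,
   so maximality leaves only the trivial ones. If AA were contained in I, then
   so would be (a,e,f), hence a, for every a in A. *)
Require Import Defs.
From HB Require Import structures.
From mathcomp Require Import all_boot all_algebra.
From mathcomp Require Import boolp.

Set Implicit Arguments.
Unset Strict Implicit.
Unset Printing Implicit Defensive.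

Import GRing.Theory.
Local Open Scope ring_scope.

Section TensorAlgebraLifts.
Variables (F : fieldType) (V : lmodType F).

(** Each element of the tensor algebra is the class of a formal expression, so structural induction
    on expressions descends to the quotient. *)
Lemma tensor_algebra_ind (P : tensor_algebra V -> Prop) :
    (forall v, P (tens_in v)) -> P 0 -> P uone ->
    (forall x y, P x -> P y -> P (x + y)) ->
    (forall k x, P x -> P (k *: x)) ->
    (forall x y, P x -> P y -> P (x • y)) ->
  forall x, P x.
Proof.
move=> PV P0 P1 PD PZ PM x; rewrite -(tensreprK x).
elim: (tensrepr x) => {x} [v | | | s Ps t Pt | k t Pt | s Ps t Pt].
- exact: PV.
- exact: P0.
- exact: P1.
- by rewrite -tensclassD; exact: PD.
- by rewrite -tensclassZ; exact: PZ.
- by rewrite -tensclassM; exact: PM.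
Qed.

(** Substitution is itself a lift, so acting by a substituted [G] amounts to lifting directly from
    the free algebra. *)
Lemma tens_lift_comp (V' : lmodType F) (B : unitalAssocAlgType F)
    (u : {linear V -> V'}) (phi : {linear V' -> B}) (G : tensor_algebra V) :
  tens_lift phi (tens_lift (@tens_in F V' \o u) G) = tens_lift (phi \o u) G.
Proof.
elim/tensor_algebra_ind: G => [v | | | x y IHx IHy | k x IHx | x y IHx IHy].
- by rewrite !tens_lift_in.
- by rewrite !linear0.
- by rewrite !tens_lift1.
- by rewrite !linearD /= IHx IHy.
- by rewrite !linearZ /= IHx.
- by rewrite !tens_liftM IHx IHy.
Qed.

Lemma tens_lift_intertwine (M N : lmodType F) (phi : {linear V -> rEnd M})
    (psi : {linear V -> rEnd N}) (h : {linear M -> N}) :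
    (forall v m, h (phi v m) = psi v (h m)) ->
  forall G m, h (tens_lift phi G m) = tens_lift psi G (h m).
Proof.
(* The vector [m] stays general: in the product case the hypothesis for [y] is used at the image of
   [m] under [x]. *)
move=> hV; elim/tensor_algebra_ind => [v | | | x y IHx IHy | k x IHx | x y IHx IHy] m.
- by rewrite !tens_lift_in.
- by rewrite (linear0 (tens_lift phi)) (linear0 (tens_lift psi)) /= linear0.
- by rewrite !tens_lift1.
- by rewrite (linearD (tens_lift phi)) (linearD (tens_lift psi)) /= linearD IHx IHy.
- by rewrite (linearZ_LR (tens_lift phi)) (linearZ_LR (tens_lift psi)) /= linearZ /= IHx.
- by rewrite !tens_liftM /= IHy IHx.
Qed.

End TensorAlgebraLifts.

Section FinitelyManyGenerators.
Variables (F : fieldType) (A : novikovAlgType F).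

(** An expression representing [f] contains finitely many generators; [n] exceeds all their indices.
    This is what makes a fresh generator available. *)
Lemma nov_eval_finite_support (f : free_novikov F) :
  exists n, forall a b : nat -> A, (forall i, (i < n)%N -> a i = b i) ->
    nov_eval a f = nov_eval b f.
Proof.
rewrite -(novreprK f).
elim: (novrepr f) => {f} [i | | s [n Hn] t [p Hp] | k t [n Hn] | s [n Hn] t [p Hp]].
- by exists i.+1 => a b ab; rewrite !nov_evalE /= ab.
- by exists 0%N => a b _; rewrite !nov_evalE.
- exists (maxn n p) => a b ab; rewrite -novclassD !linearD /=.
  by rewrite (Hn a b) ?(Hp a b) // => i ltin; apply: ab; rewrite leq_max ltin ?orbT.
- by exists n => a b ab; rewrite -novclassZ !linearZ /= (Hn a b).
- exists (maxn n p) => a b ab; rewrite -novclassM !nov_evalM.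
  by rewrite (Hn a b) ?(Hp a b) // => i ltin; apply: ab; rewrite leq_max ltin ?orbT.
Qed.

Lemma tens_subst_finite_support (G : tensor_algebra (free_novikov F)) :
  exists n, forall a b : nat -> A, (forall i, (i < n)%N -> a i = b i) ->
    tens_subst a G = tens_subst b G.
Proof.
rewrite /tens_subst; elim/tensor_algebra_ind: G
  => [f | | | x y [n Hn] [p Hp] | k x [n Hn] | x y [n Hn] [p Hp]].
- have [n Hn] := nov_eval_finite_support f.
  by exists n => a b ab; rewrite !tens_lift_in /= (Hn a b).
- by exists 0%N => a b _; rewrite !linear0.
- by exists 0%N => a b _; rewrite !tens_lift1.
- exists (maxn n p) => a b ab; rewrite !linearD /=.
  by rewrite (Hn a b) ?(Hp a b) // => i ltin; apply: ab; rewrite leq_max ltin ?orbT.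
- by exists n => a b ab; rewrite !linearZ /= (Hn a b).
- exists (maxn n p) => a b ab; rewrite !tens_liftM.
  by rewrite (Hn a b) ?(Hp a b) // => i ltin; apply: ab; rewrite leq_max ltin ?orbT.
Qed.

Lemma quot_act_right_representation (I : rightIdeal A) :
  right_representation (quot_act I).
Proof.
move=> G GR a; apply: rEndP => q; rewrite -(vcoset_reprK q).
set x := vcoset_repr q.
have [n Gn] := tens_subst_finite_support G.
(* The generator of index [n] is fresh for [G]; [b] sends it to [x] without changing the value of
   [G]. *)
pose b i := if (i < n)%N then a i else x.
rewrite (Gn a b) => [|i ltin]; last by rewrite /b ltin.
rewrite /tens_subst tens_lift_comp.
have -> : x = nov_eval b (novX F n) by rewrite nov_evalX /b ltnn.
(* The coset of [x] is now the image of [novX F n], so [G] sends it to the image of [G] acting on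
   [novX F n] by right multiplications, which is zero. *)
rewrite -(tens_lift_intertwine (phi := @rmul F (free_novikov F))
  (h := vcoset I \o nov_eval b)) => [|f g].
  by rewrite [tens_lift _ G]GR linear0.
by rewrite /= quot_act_funE nov_evalM.
Qed.

End FinitelyManyGenerators.

Section PreimageOfSubmodule.
Variables (F : fieldType) (A : nonassocAlgType F) (I : rightIdeal A).
Variable W : submodClosed (quot_space I).
Hypothesis WA : forall q a, q \in W -> quot_act I a q \in W.

Definition vcoset_preim : {pred A} := fun x => vcoset I x \in W.

Fact vcoset_preim_submod_closed : submod_closed vcoset_preim.
Proof.
split=> [|k x y Wx Wy]; rewrite unfold_in; first by rewrite linear0 rpred0.
by rewrite linearP rpredD // rpredZ.
Qed.

Fact vcoset_preim_mul (x a : A) : x \in vcoset_preim -> x • a \in vcoset_preim.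
Proof. by rewrite !unfold_in => /(WA a); rewrite /= quot_act_funE. Qed.

HB.instance Definition _ :=
  GRing.isSubmodClosed.Build F A vcoset_preim vcoset_preim_submod_closed.
HB.instance Definition _ :=
  isRightMulClosed.Build F A vcoset_preim vcoset_preim_mul.

Lemma maximal_rightIdeal_submodule : maximal_rightIdeal I ->
  (forall q, q \in W -> q = 0) \/ (forall q, q \in W).
Proof.
case=> _ maxI; have [[x JFx] | JT] := pselect (exists x, x \notin vcoset_preim).
  (* A proper preimage lies in [I] by maximality, so every coset in [W] has its representative in
     [I]. *)
  left=> q Wq; rewrite -(vcoset_reprK q) -(linear0 (vcoset I)); apply/vcosetP.
  rewrite subr0; apply: (maxI vcoset_preim); first by exists x.
    (* The preimage contains [I], because elements of [I] have coset 0. *)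
    move=> y Iy; rewrite unfold_in.
    suff -> : vcoset I y = 0 by exact: rpred0.
    by rewrite -(linear0 (vcoset I)); apply/vcosetP; rewrite subr0.
  by rewrite unfold_in vcoset_reprK.
right=> q; apply: contrapT => /negP Wq; apply: JT.
by exists (vcoset_repr q); rewrite unfold_in vcoset_reprK.
Qed.

End PreimageOfSubmodule.

Theorem lemma3p3 (F : fieldType) (charF : 2%N \notin [pchar F])
    (A : novikovAlgType F) (I : rightIdeal A) (maxI : maximal_rightIdeal I)
    (ef : exists e f : A, forall a : A, a - associator a e f \in I) :
  exists repI : right_representation (quot_act I),
    irreducible_rightModule (RightModule repI).
Proof.
exists (quot_act_right_representation I); split=> [W WA|].
  exact: maximal_rightIdeal_submodule.
apply: contrapT => MA0.
have AAI x y : x • y \in I.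
  rewrite -[_ • _]subr0; apply/vcosetP; rewrite linear0 -quot_act_funE.
  by apply: contrapT => xy; apply: MA0; exists (vcoset I x), y.
have [e [f aef]] := ef; have [[x /negP Ix] _] := maxI; apply: Ix.
(* Split [x] as (x - (x,e,f)) + (x,e,f): the first summand is in [I] by the choice of [e] and [f],
   the second as a difference of two products. *)
rewrite -(subrK (associator x e f) x) rpredD // /associator.
by rewrite rpredD // -scaleN1r rpredZ.
Qed.
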